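(* Let $p$ be a prime and let $X$ be a strongly connected digraph of order $r$ (i.e. with $r$ vertices). Let $\alpha$ be the $\mathbb{Z}_p$-valued voltage assignment that sends all edges of $X$ to an element $\tau\in\mathbb{Z}_p^\times$. Let $(X_n)_{n\ge0}$ be the $\mathbb{Z}_p$-tower that arises from $\alpha$. If $n$ is an integer such that $\varphi(p^n)>r$, where $\varphi$ denotes Euler's totient function, then $\delta(X_n)=\delta(X_{n-1})$. In particular, $\delta(X_n)$ is uniformly bounded. Furthermore, $\delta(X_n)$ is constant for all $n$ if $p-1>r$.
   Context: **Digraphs.** A digraph $X$ consists of finite sets $V(X)$ (vertices) and $\mathbb{E}(X)$ (directed edges) with an incidence map $e\mapsto(o(e),t(e))\in V(X)\times V(X)$ (origin, terminus). It is strongly connected if for all $(v,v')$ there is a directed path from $v$ to $v'$. Given a voltage assignment $\alpha:\mathbb{E}(X)\to\mathbb{Z}_p$, the tower arising from $\alpha$ is given by the derived digraphs $X_n$ with vertices $V(X)\times\mathbb{Z}/p^n\mathbb{Z}$, edges $\mathbb{E}(X)\times\mathbb{Z}/p^n\mathbb{Z}$, and $(e,\sigma)$ going from $(o(e),\sigma)$ to $(t(e),\sigma+\alpha(e))$. **Defect.** For a digraph $Y$ with vertices $v_1,\dots,v_s$, let $A_Y$ be the matrix whose $(i,j)$-entry is the number of edges from $v_j$ to $v_i$. The zeta function is $Z_Y(u)=\prod_{[C]}(1-u^{|[C]|})^{-1}$, where $[C]$ runs over equivalence classes (under cyclic permutation) of directed cycles (closed directed paths) that are not an $m$-fold multiple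 of another cycle for any $m\ge2$, and $|[C]|$ is the number of edges; it equals the rational function $\det(\mathrm{Id}-uA_Y)^{-1}$. Put $\mathcal{BF}(Y)=\mathbb{Z}^s/(\mathrm{Id}-A_Y)\mathbb{Z}^s$, $b(Y)=\mathrm{rank}_{\mathbb{Z}}\mathcal{BF}(Y)$, $a(Y)=-\mathrm{ord}_{u=1}Z_Y(u)$, and $\delta(Y)=a(Y)-b(Y)$. *)

(* Defs.v *)
From HB Require Import structures.
From mathcomp Require Import all_boot all_order all_algebra.
From mathcomp Require Import boolp classical_sets.

Set Implicit Arguments.
Unset Strict Implicit.
Unset Printing Implicit Defensive.

Import Order.TTheory GRing.Theory Num.Theory.
Local Open Scope ring_scope.

(** * p-adic integers, as the inverse limit of the Z/p^n *)

(* For p > 0 this is 'I_(p ^ n); the shape k.+1 is what carries the additive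
   group structure of Z/kZ, also for n = 0 (unlike 'Z_(p ^ n), which is Z/2
   there). *)
Notation Zmodpn p n := 'I_(p ^ n).-1.+1.

Record padic_int (p : nat) := PadicInt {
  residue :> forall n : nat, Zmodpn p n;
  residue_compat : forall n : nat, residue n.+1 = residue n %[mod p ^ n] }.

(* Ring operations on the inverse limit are componentwise. *)
Definition padic_unit (p : nat) (x : padic_int p) : Prop :=
  exists y : padic_int p, forall n : nat, Zp_mul (x n) (y n) = Zp1.

(** * Digraphs *)

Record digraph := Digraph {
  vertex : finType;
  edge : finType;
  origin : edge -> vertex;
  terminus : edge -> vertex }.

Section Digraph.
Variable Y : digraph.

Definition strongly_connected : Prop :=
  forall v w : vertex Y,
    connect [rel x y | [exists e, (origin e == x) && (terminus e == y)]] v w.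

Definition adjacency : 'M[int]_#|vertex Y| :=
  \matrix_(i, j)
    #|[set e : edge Y | origin e == enum_val j & terminus e == enum_val i]|%:Z.

(* [cycle] also links the last edge back to the first one. *)
Definition is_cycle (c : seq (edge Y)) : bool :=
  (c != [::]) && cycle [rel e f | terminus e == origin f] c.

Definition is_multiple (c : seq (edge Y)) : Prop :=
  exists (m : nat) (D : seq (edge Y)),
    [/\ (1 < m)%N, is_cycle D & c = flatten (nseq m D)].

Definition prime_cycles (d : nat) : {set d.-tuple (edge Y)} :=
  finset (fun c : d.-tuple (edge Y) => is_cycle c && ~~ `[< is_multiple c >]).

Definition prime_cycle_classes (d : nat) : {set {set d.-tuple (edge Y)}} :=
  equivalence_partition
    [rel c c' : d.-tuple (edge Y) | [exists i : 'I_d, rot i c == c' :> seq _]]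
    (prime_cycles d).

(* Coefficient of u^k in the Euler product of the (1 - u^|C|)^-1.  Every factor
   is the geometric series of the u^i with |C| dividing i; those with |C| > k
   are 1 modulo u^k.+1, so they are left out and the others are truncated. *)
Definition zeta_coef (k : nat) : rat :=
  (\prod_(1 <= d < k.+1) \prod_(C in prime_cycle_classes d)
     \poly_(i < k.+1) (d %| i)%N%:R)`_k.

End Digraph.

(* f is the rational function whose power series at 0 has coefficients z: the
   denominator times the series is the numerator.  At most one f qualifies. *)
Definition has_expansion (f : {fraction {poly rat}}) (z : nat -> rat) : Prop :=
  forall k : nat,
    \sum_(i < k.+1) (\d_(repr f))`_i * z (k - i)%N = (\n_(repr f))`_k.

Definition ord_at (x : rat) (f : {fraction {poly rat}}) : int :=
  (mup x \n_(repr f))%:Z - (mup x \d_(repr f))%:Z.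

(* The zeta function as a rational function in u, given by its Euler product. *)
Definition zeta (Y : digraph) : {fraction {poly rat}} :=
  xget 0 (fun f => has_expansion f (zeta_coef Y)).

(** * Bowen-Franks group and defect *)

Definition mximage (s : nat) (M : 'M[int]_s) : {pred 'cV[int]_s} :=
  fun v => `[< exists w, v = M *m w >].

Fact mximage_zmod_closed (s : nat) (M : 'M[int]_s) : zmod_closed (mximage M).
Proof.
split=> [|u v]; rewrite !unfold_in.
  by apply/asboolP; exists 0; rewrite mulmx0.
move=> /asboolP[x ->] /asboolP[y ->].
by apply/asboolP; exists (x - y); rewrite mulmxBr.
Qed.

HB.instance Definition _ (s : nat) (M : 'M[int]_s) :=
  GRing.isZmodClosed.Build 'cV[int]_s (mximage M) (mximage_zmod_closed M).

Definition bowen_franks (Y : digraph) : zmodType :=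
  Quotient.quot (mximage (1%:M - adjacency Y)).

Definition zfree (M : zmodType) (k : nat) (f : 'I_k -> M) : Prop :=
  forall c : 'I_k -> int, \sum_i f i *~ c i = 0 -> forall i, c i = 0.

(* The maximal size of a Z-linearly independent family of M (0 if there is no
   maximum, which cannot happen for finitely generated M). *)
Definition zrank (M : zmodType) : nat :=
  xget 0%N (fun k => (exists f : 'I_k -> M, zfree f) /\
    forall (l : nat) (g : 'I_l -> M), zfree g -> (l <= k)%N).

Definition a_inv (Y : digraph) : int := - ord_at 1 (zeta Y).
Definition b_inv (Y : digraph) : nat := zrank (bowen_franks Y).
Definition defect (Y : digraph) : int := a_inv Y - (b_inv Y)%:Z.

(** * The Z_p-tower arising from a voltage assignment *)

Definition derived (p : nat) (X : digraph) (alpha : edge X -> padic_int p)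
    (n : nat) : digraph :=
  @Digraph (vertex X * Zmodpn p n)%type (edge X * Zmodpn p n)%type
    (fun es => (origin es.1, es.2))
    (fun es => (terminus es.1, es.2 + alpha es.1 n)).

(* Main.v *)
(* Write A for the adjacency matrix of X, N = p^n and r for the order of X.  As tau
   is a unit, a walk of length k in X_n from (v, s) ends at level s + k tau, so
   X_n has N tr(A^k) closed walks of length k if N divides k, and none
   otherwise.  Comparing logarithmic derivatives, the Euler product of X_n is
   1 / det(1 - u^N A^N); hence a(X_n) is the multiplicity of 1 as a root of
   det(1 - u^N A^N).  Likewise b(X_n) is the nullity of 1 - A_(X_n), which equals
   that of 1 - A^N.
     With M = p^(n-1) and Phi = 1 + x^M + ... + x^(M(p-1)), one has
   1 - (uA)^N = (1 - (uA)^M) Phi(uA).  Since Phi is the p^n-th cyclotomic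
   polynomial, of degree phi(p^n) > r and irreducible over Q, it is coprime to
   the characteristic polynomial of A, so Phi(A) is invertible and neither a nor b
   changes from X_(n-1) to X_n. *)

From mathcomp Require Import boolp classical_sets.
Require Import Defs.
From mathcomp Require Import all_boot all_order all_algebra.
From mathcomp Require Import algC cyclotomic.

Set Implicit Arguments.
Unset Strict Implicit.
Unset Printing Implicit Defensive.

Import Order.TTheory GRing.Theory Num.Theory.
Local Open Scope ring_scope.

(** * Words and prime cycles *)

Section Words.
Local Open Scope nat_scope.
Variable T : eqType.
Implicit Types (s w D : seq T) (a b d m : nat).

Lemma size_flatten_nseq m D : size (flatten (nseq m D)) = m * size D.
Proof. by rewrite size_flatten /shape map_nseq sumn_nseq mulnC. Qed.

Lemma cat_flatten_nseq m D :
  D ++ flatten (nseq m D) = flatten (nseq m D) ++ D.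
Proof. by elim: m => [|m IHm] /=; rewrite ?cats0 // IHm catA IHm. Qed.

Lemma rot_flatten_nseq m D :
  rot (size D) (flatten (nseq m D)) = flatten (nseq m D).
Proof. by case: m => [|m] //=; rewrite rot_size_cat cat_flatten_nseq. Qed.

(** Comparing prefixes in [D ++ w = w ++ D] shows that a nonempty power [w] begins with [D];
    cancelling that copy leaves a shorter word that still commutes with [D]. *)
Lemma commute_flatten_nseq m D w :
  D ++ w = w ++ D -> size w = m * size D -> w = flatten (nseq m D).
Proof.
elim: m w => [|m IHm] w Dw sz_w /=; first exact: size0nil.
have le_Dw : size D <= size w by rewrite sz_w mulSn leq_addr.
have w_def : w = D ++ drop (size D) w.
  rewrite -[LHS](cat_take_drop (size D)); congr (_ ++ _).
  by rewrite -(takel_cat D le_Dw) -Dw take_size_cat.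
move: Dw sz_w; rewrite w_def -catA size_cat mulSn => Dw /addnI sz_w.
congr (_ ++ _); apply: IHm => //.
by have /eqP := Dw; rewrite eqseq_cat // eqxx => /eqP.
Qed.

(** A word fixed by the rotation by [d] commutes with its prefix of length [d]. *)
Lemma rot_fix_flatten d k s : size s = k ->
  d %| k -> rot d s = s -> s = flatten (nseq (k %/ d) (take d s)).
Proof.
move=> <-; case: (posnP d) => [->|d_gt0 dvd_s rot_s].
  by rewrite dvd0n => /eqP/size0nil->.
case: (posnP (size s)) => [/size0nil->|s_gt0]; first by rewrite div0n.
have le_ds := dvdn_leq s_gt0 dvd_s.
apply: commute_flatten_nseq; last by rewrite size_takel // divnK.
by rewrite -{2}rot_s /rot catA cat_take_drop.
Qed.

(** Euclid's algorithm by subtraction: if the rotations by [a <= b] fix [s], so does the rotation by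
    [b - a]. *)
Lemma rot_fix_gcd a b s : a <= size s -> b <= size s ->
  rot a s = s -> rot b s = s -> rot (gcdn a b) s = s.
Proof.
have [n] := ubnP (a + b); elim: n => // n IHn in a b *.
wlog le_ab : a b / a <= b.
  move=> IH; case: (leqP a b) => [/IH//|/ltnW le_ba].
  by rewrite addnC gcdnC => ? ? ? ? ?; apply: IH.
case: (posnP a) => [->|a_gt0]; first by rewrite gcd0n.
rewrite ltnS => le_n le_as le_bs rot_a rot_b.
rewrite -(subnKC le_ab) gcdnDl; apply: IHn => //.
- by rewrite subnKC // (leq_trans _ le_n) // -{1}[b]add0n ltn_add2r.
- exact: leq_trans (leq_subr _ _) le_bs.
- by rewrite -{1}rot_a -rotD subnK.
Qed.

End Words.

Section PrimeCycles.
Local Open Scope nat_scope.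
Variable Y : digraph.
Implicit Types (d k m : nat).

Lemma is_cycle_flatten_nseq m (D : seq (edge Y)) :
  0 < m -> is_cycle (flatten (nseq m D)) = is_cycle D.
Proof.
case: m D => // m [|e D] _.
  by rewrite /= (_ : flatten _ = [::]) //; elim: m.
rewrite /is_cycle /=; set R : rel (edge Y) := (X in path X).
elim: m => [|m IHm] /=; first by rewrite cats0.
by rewrite rcons_cat cat_path /= IHm !rcons_path; case: (path R e D); case: (R _ _).
Qed.

(** A rotation by [d] fixing [c] yields one by gcd(d, |c|), a proper divisor of the length, which
    exhibits [c] as a multiple. *)
Lemma not_multipleP (c : seq (edge Y)) : is_cycle c ->
  ~ is_multiple c <-> (forall d, 0 < d < size c -> rot d c <> c).
Proof.
move=> cyc_c; split=> [nmul d /andP[d_gt0 lt_dc] rot_c|].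
  apply: nmul; set g := gcdn d (size c).
  have g_gt0 : 0 < g by rewrite gcdn_gt0 d_gt0.
  have rot_g : rot g c = c by apply: rot_fix_gcd; rewrite ?rot_size // ltnW.
  have lt_gc : g < size c by rewrite (leq_ltn_trans _ lt_dc) // dvdn_leq // dvdn_gcdl.
  have m_gt1 : 1 < size c %/ g by rewrite ltn_divRL ?dvdn_gcdr ?mul1n.
  have c_def := rot_fix_flatten erefl (dvdn_gcdr _ _) rot_g.
  exists (size c %/ g), (take g c); split=> //.
  by rewrite -(is_cycle_flatten_nseq _ (ltnW m_gt1)) -c_def.
move=> prim [m [D [m_gt1 cyc_D c_def]]].
have D_gt0 : 0 < size D by rewrite lt0n size_eq0; case/andP: cyc_D.
apply: (prim (size D)); last by rewrite c_def rot_flatten_nseq.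
by rewrite D_gt0 c_def size_flatten_nseq ltn_Pmull.
Qed.

Lemma prime_cyclesP d (c : d.-tuple (edge Y)) :
  reflect (is_cycle c /\ forall i, 0 < i < d -> rot i c <> c :> seq _)
          (c \in prime_cycles Y d).
Proof.
rewrite inE; apply: (iffP andP) => -[cyc_c].
  by move/asboolPn/(not_multipleP cyc_c); rewrite size_tuple.
move=> prim; split=> //; apply/asboolPn/(not_multipleP cyc_c).
by rewrite size_tuple.
Qed.

Definition cycles k : {set k.-tuple (edge Y)} :=
  finset (fun c : k.-tuple (edge Y) => is_cycle c).

Lemma card_cycles_prime k : 0 < k ->
  #|cycles k| = \sum_(1 <= d < k.+1 | d %| k) #|prime_cycles Y d|.
Proof.
move=> k_gt0; pose P (c : k.-tuple (edge Y)) d :=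
  [&& 0 < d, d %| k & rot d c == c :> seq _].
have exP (c : k.-tuple (edge Y)) : exists d, P c d.
  by exists k; rewrite /P k_gt0 dvdnn -{1}(size_tuple c) rot_size eqxx.
(* A cycle c is the (k / per c)-fold multiple of the prime cycle formed by its
   first [per c] edges, where [per c] is its least rotation period. *)
pose per (c : k.-tuple (edge Y)) := ex_minn (exP c).
have per_le (c : k.-tuple (edge Y)) : per c < k.+1.
  rewrite ltnS /per; case: ex_minnP => d /and3P[_ dvd_d _] _.
  exact: dvdn_leq.
rewrite -sum1_card (partition_big (fun c => Ordinal (per_le c)) predT) //=.
rewrite -(big_mkord predT (fun d => \sum_(c in cycles k | per c == d) 1)).
rewrite big_ltn // big1 ?add0n; last first.
  move=> c /andP[_ /eqP]; rewrite /per.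
  by case: ex_minnP => d /and3P[d_gt0 _ _] _ d0; rewrite d0 in d_gt0.
rewrite [RHS]big_mkcond; apply: eq_big_nat => d /andP[d_gt0 _].
case: (boolP (d %| k)) => [dvd_d|ndvd_d]; last first.
  rewrite big1 // => c /andP[_ /eqP]; rewrite /per.
  by case: ex_minnP => d' /and3P[_ dvd_d' _] _ E; rewrite -E dvd_d' in ndvd_d.
have sz_f (D : d.-tuple (edge Y)) : size (flatten (nseq (k %/ d) (tval D))) == k.
  by rewrite size_flatten_nseq size_tuple divnK.
have m_gt0 : 0 < k %/ d by rewrite divn_gt0 // dvdn_leq.
have le_dk : d <= k by apply: dvdn_leq.
pose f (D : d.-tuple (edge Y)) := Tuple (sz_f D).
have take_f (D : d.-tuple (edge Y)) : take d (f D) = D :> seq _.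
  rewrite /f /=; case: (k %/ d) m_gt0 => //= m _.
  by rewrite take_size_cat ?size_tuple.
rewrite sum1dep_card -(card_imset _ (f := f)); last first.
  by move=> D1 D2 E; apply: val_inj; rewrite /= -(take_f D1) E take_f.
apply: eq_card => c; rewrite inE; apply/andP/imsetP => [[]|[D D_prim ->]].
  rewrite inE => cyc_c /eqP; rewrite /per.
  case: ex_minnP => d' /and3P[_ _ /eqP rot_c] min_d' d'E.
  subst d'.
  have c_def : c = flatten (nseq (k %/ d) (take d c)) :> seq _.
    by apply: rot_fix_flatten; rewrite ?size_tuple.
  have sz_D : size (take d c) == d by rewrite size_takel ?size_tuple.
  exists (Tuple sz_D); last exact: val_inj.
  apply/prime_cyclesP; rewrite /=; split.
    by rewrite -(is_cycle_flatten_nseq _ m_gt0) -c_def.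
  (* Otherwise gcd(i, d) < d would be a period of [D], hence of [c], against the minimality of
     [d]. *)
  move=> i /andP[i_gt0 lt_id] rot_i.
  have rot_g : rot (gcdn i d) (take d c) = take d c.
    apply: rot_fix_gcd; rewrite ?(eqP sz_D) // ?(ltnW lt_id) //.
    by rewrite -{1}(eqP sz_D) rot_size.
  have D_def := rot_fix_flatten (eqP sz_D) (dvdn_gcdr i d) rot_g.
  have : d <= gcdn i d.
    apply: min_d'; rewrite /P gcdn_gt0 i_gt0 (dvdn_trans (dvdn_gcdr _ _)) //=.
    apply/eqP; rewrite c_def {1 2}D_def.
    have -> m1 m2 (s : seq (edge Y)) : flatten (nseq m1 (flatten (nseq m2 s)))
        = flatten (nseq (m1 * m2) s).
      elim: m1 => //= m1 ->; rewrite mulSn nseqD flatten_cat //.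
    rewrite -[X in rot X](_ : size (take (gcdn i d) (take d c)) = gcdn i d).
      exact: rot_flatten_nseq.
    by rewrite size_takel // (eqP sz_D) dvdn_leq // dvdn_gcdr.
  by rewrite leqNgt (leq_ltn_trans _ lt_id) // dvdn_leq // dvdn_gcdl.
have [cyc_D prim] := prime_cyclesP _ D_prim.
rewrite inE /= is_cycle_flatten_nseq //; split=> //.
apply/eqP; rewrite /per.
case: ex_minnP => d' /and3P[d'_gt0 dvd_d' /eqP rot_d'] min_d'.
have rot_d : rot d (f D) = f D.
  by rewrite -[X in rot X](size_tuple D) rot_flatten_nseq.
have le_d'd : d' <= d by apply: min_d'; rewrite /P d_gt0 dvd_d rot_d eqxx.
(* If the multiple [f D] had a period d' < d, it would have the period gcd(d', d); as this divides
   [d], it is also a period of [D], which is prime. *)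
apply/eqP; rewrite eqn_leq le_d'd leqNgt; apply/negP => lt_d'd.
have rot_g : rot (gcdn d' d) (f D) = f D.
  by apply: rot_fix_gcd; rewrite ?size_tuple // dvdn_leq.
have g_gt0 : 0 < gcdn d' d by rewrite gcdn_gt0 d'_gt0.
have lt_gd : gcdn d' d < d by rewrite (leq_ltn_trans _ lt_d'd) // dvdn_leq // dvdn_gcdl.
apply: (prim (gcdn d' d)); first by rewrite g_gt0.
have f_def : f D = flatten (nseq (k %/ gcdn d' d) (take (gcdn d' d) D)) :> seq _.
  rewrite -(take_f D) take_takel ?(ltnW lt_gd) //.
  apply: rot_fix_flatten rot_g; rewrite ?size_tuple //.
  exact: dvdn_trans (dvdn_gcdr _ _) dvd_d.
have D_def : D = flatten (nseq (d %/ gcdn d' d) (take (gcdn d' d) D)) :> seq _.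
  have k_def : k %/ gcdn d' d = d %/ gcdn d' d + (k %/ gcdn d' d - d %/ gcdn d' d).
    by rewrite subnKC // leq_div2r.
  rewrite -{1}(take_f D) f_def k_def nseqD flatten_cat take_size_cat //.
  rewrite size_flatten_nseq size_takel ?size_tuple ?(ltnW lt_gd) //.
  by rewrite divnK // dvdn_gcdr.
rewrite D_def -[X in rot X](_ : size (take (gcdn d' d) D) = gcdn d' d).
  exact: rot_flatten_nseq.
by rewrite size_takel // size_tuple ltnW.
Qed.

End PrimeCycles.

(** * Classes of prime cycles under rotation *)

Section CycleClasses.
Local Open Scope nat_scope.
Variable (Y : digraph) (d : nat).

Let rot_rel := [rel c c' : d.-tuple (edge Y) |
  [exists i : 'I_d, rot i c == c' :> seq _]].

Lemma is_cycle_rot i (c : seq (edge Y)) : is_cycle (rot i c) = is_cycle c.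
Proof. by rewrite /is_cycle rot_cycle -!size_eq0 size_rot. Qed.

Lemma rot_relP (c c' : d.-tuple (edge Y)) :
  reflect (exists2 i, i < d & rot i c = c' :> seq _) (rot_rel c c').
Proof.
apply: (iffP existsP) => [[i /eqP rot_i]|[i lt_id rot_i]]; first by exists i.
by exists (Ordinal lt_id); apply/eqP.
Qed.

(** Rotation by [d] is the identity, so it can be replaced by the index 0. Composing and inverting
    rotations may produce this extra value. *)
Lemma rot_rel_leq (c c' : d.-tuple (edge Y)) i : 0 < d ->
  i <= d -> rot i c = c' :> seq _ -> rot_rel c c'.
Proof.
move=> d_gt0; rewrite leq_eqVlt => /predU1P[->|lt_id] rot_i; apply/rot_relP.
  by exists 0; rewrite // rot0 -rot_i -{2}(size_tuple c) rot_size.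
by exists i.
Qed.

Lemma rot_rel_equiv : 0 < d ->
  {in prime_cycles Y d & &, equivalence_rel rot_rel}.
Proof.
move=> d_gt0; have rot_refl : reflexive rot_rel.
  by move=> c; apply/rot_relP; exists 0; rewrite ?rot0.
have rot_trans : transitive rot_rel.
  move=> c2 c1 c3 /rot_relP[i lt_id rot_i] /rot_relP[j lt_jd rot_j].
  have := @rot_add_mod _ j i c1.
  rewrite !size_tuple rot_i rot_j => /(_ (ltnW lt_id) (ltnW lt_jd)) rot_ij.
  apply: (rot_rel_leq d_gt0 _ (esym rot_ij)).
  case: (leqP (j + i) d) => // _.
  by rewrite leq_subLR (leq_add (ltnW lt_jd) (ltnW lt_id)).
have rot_sym : symmetric rot_rel.
  suff sub c c' : rot_rel c c' -> rot_rel c' c.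
    by move=> c c'; apply/idP/idP; apply: sub.
  case/rot_relP=> i lt_id rot_i; apply: (@rot_rel_leq _ _ (d - i)) => //.
    exact: leq_subr.
  by rewrite -rot_i -{1}(size_tuple c) -(size_rot i) -/(rotr i _) rotK.
move=> c1 c2 c3 _ _ _; split; first exact: rot_refl.
move=> R12; apply/idP/idP => [R13|R23]; last exact: rot_trans R23.
by apply: (rot_trans c1); rewrite // rot_sym.
Qed.

(** The [d] rotations of a prime cycle are pairwise distinct, so each class has exactly [d]
    elements. *)
Lemma card_prime_cycles : 0 < d ->
  #|prime_cycles Y d| = #|prime_cycle_classes Y d| * d.
Proof.
move=> d_gt0.
apply: card_uniform_partition (equivalence_partitionP (rot_rel_equiv d_gt0)).
move=> _ /imsetP[c c_prim ->]; have [cyc_c prim] := prime_cyclesP _ c_prim.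
pose f (i : 'I_d) := rot_tuple i c.
have f_inj : injective f.
  suff lt_inj (i j : 'I_d) : i < j -> f i <> f j.
    move=> i j f_ij; apply: val_inj; case: (ltngtP i j) => // /lt_inj //.
    by rewrite f_ij.
  move=> lt_ij /(congr1 val) /= f_ij; apply: (prim (j - i)).
    by rewrite subn_gt0 lt_ij (leq_ltn_trans (leq_subr _ _)).
  apply: (@rot_inj i); rewrite -rotD ?subnKC ?f_ij ?size_tuple // ltnW //.
rewrite -[RHS]card_ord -(card_imset _ f_inj); apply: eq_card => c'.
rewrite inE; apply/andP/imsetP => [[_ /rot_relP[i lt_id rot_i]]|[i _ ->]].
  by exists (Ordinal lt_id) => //; apply: val_inj; rewrite /= rot_i.
split; last by apply/rot_relP; exists i.
apply/prime_cyclesP; rewrite is_cycle_rot; split=> // j j_lt.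
by rewrite /= rot_rot => /rot_inj; apply: prim.
Qed.

End CycleClasses.
(** * Walks in derived digraphs *)

Section Walks.
Local Open Scope nat_scope.
Variable Y : digraph.
Implicit Types (v w : vertex Y) (k : nat).

Fixpoint walk v (s : seq (edge Y)) w : bool :=
  if s is e :: s' then (origin e == v) && walk (terminus e) s' w else v == w.

Fixpoint nwalks k v w : nat :=
  if k is k'.+1 then \sum_(e | origin e == v) nwalks k' (terminus e) w
  else v == w.

Lemma big_tuple_cons (I : finType) k (F : seq I -> nat) :
  \sum_(t : k.+1.-tuple I) F t = \sum_i \sum_(t : k.-tuple I) F (i :: t).
Proof.
rewrite pair_big /= (reindex (fun p : I * k.-tuple I => cons_tuple p.1 p.2)) //=.
exists (fun t => (thead t, behead_tuple t)) => [[i t]|t] _ /=.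
  by rewrite theadE; congr (_, _); apply: val_inj.
by rewrite [RHS]tuple_eta; apply: val_inj.
Qed.

Lemma sum_walk k v w : \sum_(s : k.-tuple (edge Y)) walk v s w = nwalks k v w.
Proof.
elim: k v => [|k IHk] v /=.
  rewrite (eq_bigr (fun=> (v == w) : nat)) => [|t _]; last by rewrite tuple0.
  by rewrite sum_nat_const card_tuple expn0 mul1n.
rewrite (big_tuple_cons _ (fun s => walk v s w)) [RHS]big_mkcond /=.
apply: eq_bigr => e _; case: eqP => _ /=; last by rewrite big1.
exact: IHk.
Qed.

Lemma path_walk (e f : edge Y) s :
  path [rel e f | terminus e == origin f] e (rcons s f)
  = walk (terminus e) s (origin f).
Proof.
by elim: s e => [|g s IHs] e /=; rewrite ?andbT // IHs eq_sym.
Qed.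

(** A cycle is a closed walk at exactly one base point, the origin of its first edge. *)
Lemma card_cycles k : 0 < k -> #|cycles Y k| = \sum_v nwalks k v v.
Proof.
case: k => // k _; under [RHS]eq_bigr do rewrite -sum_walk.
rewrite exchange_big /= -sum1_card big_mkcond.
apply: eq_bigr => c _; rewrite inE; case/tupleP: c => e s.
rewrite /is_cycle /= path_walk (bigD1 (origin e)) //= eqxx /= big1 ?addn0.
  by case: (walk _ _ _).
by move=> v /negPf; rewrite eq_sym => ->.
Qed.

(** Columns of [adjacency] index origins, so the rightmost factor of the power accounts for the
    first edge of the walk. *)
Lemma nwalks_adjacency k i j :
  (adjacency Y ^+ k) i j = nwalks k (enum_val j) (enum_val i) :> int.
Proof.
elim: k i j => [|k IHk] i j /=.
  by rewrite expr0 mxE (inj_eq enum_val_inj) eq_sym natz.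
rewrite exprSr mxE.
under [LHS]eq_bigr => l _ do rewrite IHk mxE -sum1dep_card.
rewrite (partition_big (@terminus Y) predT) //= -natz raddf_sum /=.
rewrite (reindex (@enum_val _ (mem (vertex Y)))) /=; last first.
  exact/onW_bij/enum_val_bij.
apply: eq_bigr => l _.
rewrite -PoszM natz; congr Posz.
by rewrite big_distrr; apply: eq_bigr => e /andP[_ /eqP->]; rewrite /= muln1.
Qed.

End Walks.

(** * Closed walks in the tower of a constant unit voltage *)

Section ConstantVoltage.
Variables (p : nat) (X : digraph) (tau : padic_int p).
Variable alpha : edge X -> padic_int p.
Hypotheses (p_pr : prime p) (tau_unit : padic_unit tau).
Hypothesis alphaE : forall e : edge X, alpha e = tau.

(** Every edge shifts the level by [tau n]: a walk of X lifts uniquely from each starting level, and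
    its final level depends only on its length. *)
Lemma nwalks_derived n k (v w : vertex X) (s t : Zmodpn p n) :
  nwalks (Y := derived alpha n) k (v, s) (w, t)
  = if t == s + tau n *+ k then nwalks k v w else 0%N.
Proof.
elim: k v s => [|k IHk] v s /=.
  rewrite mulr0n addr0 xpair_eqE [s == t]eq_sym.
  by case: (t == s); rewrite ?andbF ?andbT.
transitivity (\sum_(e | origin e == v)
    (if (t == s + tau n *+ k.+1)%R then nwalks k (terminus e) w else 0%N))%N.
  rewrite (eq_bigl (fun e : edge X * Zmodpn p n =>
      (origin e.1 == v) && (e.2 == s))).
    rewrite -(pair_big (fun e : edge X => origin e == v)
      (fun a : Zmodpn p n => a == s)
      (fun e a => nwalks (Y := derived alpha n) k
                    (terminus e, a + alpha e n) (w, t))) /=.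
    apply: eq_bigr => e _; by rewrite big_pred1_eq IHk alphaE mulrS addrA.
  by move=> [e a]; rewrite xpair_eqE.
by case: ifP => // _; rewrite big1.
Qed.

Lemma Zmodpn_card n : (p ^ n).-1.+1 = (p ^ n)%N.
Proof. by rewrite prednK // expn_gt0 prime_gt0. Qed.

Lemma voltage_inverse n : exists y : nat, y * tau n = 1 %[mod p ^ n].
Proof.
have [y yP] := tau_unit; exists (y n : nat).
have /(congr1 val) /= := yP n; move: (nat_of_ord _) (nat_of_ord _) => a b.
by rewrite Zmodpn_card mulnC.
Qed.

(** Multiplying [k * tau n] by an inverse of [tau n] recovers [k] modulo p^n. *)
Lemma voltage_mulrn_eq0 n k : (tau n *+ k == 0) = (p ^ n %| k)%N.
Proof.
have [y] := voltage_inverse n.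
rewrite Zp_mulrn -val_eqE /=; move: (nat_of_ord _) => a yP.
rewrite Zmodpn_card.
apply/eqP/eqP => [tau_k|k0]; last by rewrite -modnMmr k0 muln0 mod0n.
by rewrite -[k]mul1n -modnMml -yP modnMml -mulnA -modnMmr tau_k muln0 mod0n.
Qed.

Lemma card_cycles_derived n k : (0 < k)%N ->
  #|cycles (derived alpha n) k|%:Z
  = if (p ^ n %| k)%N then \tr (adjacency X ^+ k) *+ (p ^ n) else 0.
Proof.
move=> k_gt0; rewrite card_cycles //.
transitivity (\sum_(v : vertex X) \sum_(s : Zmodpn p n)
    if (p ^ n %| k)%N then (nwalks k v v)%:Z else 0).
  rewrite -natz natr_sum pair_bigA; apply: eq_bigr => -[v s] _ /=.
  rewrite nwalks_derived -{1}[s]addr0 (inj_eq (addrI s)) eq_sym.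
  by rewrite voltage_mulrn_eq0 natz; case: ifP.
case: ifP => _; last by rewrite big1 // => v _; rewrite big1.
under eq_bigr => v _ do rewrite sumr_const card_ord Zmodpn_card.
rewrite sumrMnl; congr (_ *+ _).
rewrite (reindex (@enum_val _ (mem (vertex X)))) /=; last first.
  exact/onW_bij/enum_val_bij.
by apply: eq_bigr => i _; rewrite nwalks_adjacency.
Qed.

End ConstantVoltage.
(** * The logarithmic derivative of a determinant *)

Section JacobiFormula.
Variable R : comNzRingType.

Lemma deriv_prod_seq (I : eqType) (r : seq I) (F : I -> {poly R}) : uniq r ->
  (\prod_(i <- r) F i)^`()
  = \sum_(i <- r) (F i)^`() * \prod_(j <- r | j != i) F j.
Proof.
elim: r => [|i r IHr] /=; first by rewrite !big_nil derivC.
case/andP=> i_r r_uniq; rewrite !big_cons eqxx derivM (IHr r_uniq) /=.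
rewrite mulr_sumr; congr (_ * _ + _).
  rewrite big_seq_cond [RHS]big_seq_cond; apply: eq_bigl => j.
  by case: (boolP (j \in r)) => //= j_r; rewrite (memPn i_r).
apply: eq_big_seq => j j_r.
by rewrite big_cons eq_sym (memPn i_r) // mulrCA.
Qed.

(** Jacobi's formula. By the Leibniz expansion the derivative is the sum over [i] of the
    determinants with row [i] differentiated; expanding each along that row gives the cofactors. *)
Lemma deriv_det (n : nat) (M : 'M[{poly R}]_n) :
  (\det M)^`() = \tr (map_mx (@deriv R) M *m \adj M).
Proof.
pose M' i := \matrix_(k, j) if k == i then (M i j)^`() else M k j.
transitivity (\sum_i \det (M' i)).
  rewrite /determinant raddf_sum exchange_big /=; apply: eq_bigr => s _.
  rewrite -mulr_sumr derivM [X in X * _](_ : _ = 0) ?mul0r ?add0r; last first.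
    by case: (perm.odd_perm s); rewrite ?expr0 ?expr1 ?derivN derivC ?oppr0.
  rewrite deriv_prod_seq ?index_enum_uniq //; congr (_ * _); apply: eq_bigr => i _.
  rewrite [RHS](bigD1 i) //= mxE eqxx; congr (_ * _).
  by apply: eq_bigr => j /negPf ji; rewrite mxE ji.
apply: eq_bigr => i _; rewrite (expand_det_row _ i) mxE.
apply: eq_bigr => j _; rewrite !mxE eqxx; congr (_ * (_ * \det _)).
by apply/matrixP => k l; rewrite !mxE eq_sym (negPf (neq_lift _ _)).
Qed.

End JacobiFormula.

Section DetOneSubXnM.
Variables (F : fieldType) (m N : nat) (C : 'M[F]_m).

Lemma expmx_scaleX k : ('X^N *: map_mx polyC C) ^+ k
  = 'X^(N * k) *: map_mx polyC (C ^+ k) :> 'M_m.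
Proof.
elim: k => [|k IHk]; first by rewrite muln0 !expr0 scale1r map_mx1.
rewrite !exprSr IHk -!mulmxE map_mxM -scalemxAl -scalemxAr scalerA -exprD.
by rewrite mulnSr.
Qed.

(** With N = p^n and C = A^N this is the reciprocal of the zeta function of X_n. *)
Definition det1_sub_XnM : {poly F} := \det (1%:M - 'X^N *: map_mx polyC C).

(** The expansion - X D' / D = sum of N tr(C^k) X^(Nk) over k >= 1, cleared of denominators and
    truncated. With B the adjugate of 1 - Z, Jacobi's formula gives X D' = - N tr(Z B), and D times
    the geometric sum of the Z^k is B - B Z^(K+1). Everything cancels except - N tr(B Z^(K+1)), a
    multiple of X^(N(K+1)). *)
Lemma log_deriv_det1_sub_XnM K : (0 < N)%N ->
  'X^(N * K.+1) %| 'X * det1_sub_XnM^`()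
    + det1_sub_XnM * \sum_(1 <= k < K.+1) (\tr (C ^+ k) *+ N) *: 'X^(N * k).
Proof.
move=> N_gt0; pose Z : 'M_m := 'X^N *: map_mx polyC C; set D := det1_sub_XnM.
have trZ k : \tr (Z ^+ k) = \tr (C ^+ k) *: 'X^(N * k).
  by rewrite expmx_scaleX mxtraceZ trace_map_mx mulrC mul_polyC.
have XdM : 'X *: map_mx (@deriv F) (1%:M - Z) = Z *- N.
  apply/matrixP => i j; rewrite !mxE mulmxnE !mxE derivB derivMn derivC mul0rn sub0r.
  rewrite derivM derivC mulr0 addr0 derivXn mulrN mulrnAl mulrnAr mulrA -exprS.
  by rewrite prednK.
set B := \adj (1%:M - Z).
have BZ : B *m Z = B - D%:M.
  by rewrite -mul_adj_mx mulmxBr mulmx1 opprB addrCA subrr addr0.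
have XdD : 'X * D^`() = - ((\tr B - D *+ m) *+ N).
  have -> : \tr B - D *+ m = \tr (Z *m B).
    by rewrite mxtrace_mulC BZ raddfB /= mxtrace_scalar.
  rewrite deriv_det -mxtraceZ scalemxAl XdM mulNmx raddfN /= -(scaler_nat N Z).
  by rewrite -scalemxAl mxtraceZ mulr_natl.
have geo : D *: \sum_(k < K.+1) Z ^+ k = B - B *m Z ^+ K.+1.
  rewrite -{1}[B]mulmx1 -mulmxBr.
  have <- : (1%:M - Z) *m \sum_(k < K.+1) Z ^+ k = 1%:M - Z ^+ K.+1.
    by rewrite -[1%:M - Z]opprB mulNmx; rewrite -[RHS]opprB subrX1.
  by rewrite mulmxA mul_adj_mx mul_scalar_mx.
have {}geo : D * \sum_(1 <= k < K.+1) (\tr (C ^+ k) *+ N) *: 'X^(N * k)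
    = (\tr B - \tr (B *m Z ^+ K.+1) - D *+ m) *+ N.
  rewrite -raddfB /= -geo mxtraceZ raddf_sum /=.
  rewrite -(big_mkord predT (fun k => \tr (Z ^+ k))).
  rewrite [in RHS]big_ltn // expr0 mxtrace1 mulrDr mulr_natr addrAC subrr add0r.
  rewrite -mulrnAr -sumrMnl; congr (_ * _); apply: eq_bigr => k _.
  by rewrite trZ scalerMnl.
rewrite XdD geo addrC -mulrnBl opprB addrA subrK addrAC subrr sub0r mulNrn.
rewrite dvdpNr expmx_scaleX -scalemxAr mxtraceZ -mulrnAr dvdp_mulIl //.
Qed.

End DetOneSubXnM.
(** * The zeta function as a determinant *)

Section TruncatedSeries.
Variable F : fieldType.
Implicit Types (p q P Q S : {poly F}) (n : nat).

Definition congX n p q := 'X^n %| p - q.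

Lemma congXP n p q :
  reflect (forall i, (i < n)%N -> p`_i = q`_i) (congX n p q).
Proof.
apply: (iffP idP) => [/dvdpP[r pq_r] i lt_in|pq].
  by apply/eqP; rewrite -subr_eq0 -coefB pq_r coefMXn lt_in.
rewrite /congX -(poly_take_drop n (p - q)) (_ : take_poly n _ = 0).
  by rewrite add0r dvdp_mulIr.
apply/polyP => i; rewrite coef_take_poly coef0 coefB.
by case: ltnP => // /pq->; rewrite subrr.
Qed.

Lemma congX_refl n p : congX n p p.
Proof. by rewrite /congX subrr dvdp0. Qed.

Lemma congX_sym n p q : congX n p q -> congX n q p.
Proof. by rewrite /congX -opprB dvdpNr. Qed.

Lemma congX_trans n p q r : congX n p q -> congX n q r -> congX n p r.
Proof. by move=> pq qr; rewrite /congX -(subrKA q) dvdp_add. Qed.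

Lemma congXW m n p q : (m <= n)%N -> congX n p q -> congX m p q.
Proof. by move=> le_mn; apply/dvdp_trans/dvdp_exp2l. Qed.

Lemma congX_mul n p1 p2 q1 q2 :
  congX n p1 p2 -> congX n q1 q2 -> congX n (p1 * q1) (p2 * q2).
Proof.
move=> p12 q12; rewrite /congX -(subrKA (p1 * q2)) -mulrBr -mulrBl.
by apply: dvdp_add; [apply: dvdp_mull|apply: dvdp_mulr].
Qed.

Lemma congX_eq p q : (forall n, congX n p q) -> p = q.
Proof. by move=> pq; apply/polyP => i; apply: (congXP _ _ _ (pq i.+1)). Qed.

(* S is - X P' / P modulo X^n *)
Definition nlogderiv n P S := congX n ('X * P^`() + P * S) 0.

Lemma nlogderiv1 n : nlogderiv n 1 0.
Proof. by rewrite /nlogderiv derivC !mulr0 addr0 congX_refl. Qed.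

Lemma nlogderivM n P Q S T :
  nlogderiv n P S -> nlogderiv n Q T -> nlogderiv n (P * Q) (S + T).
Proof.
rewrite /nlogderiv /congX !subr0 => PS QT; rewrite derivM !mulrDr.
rewrite addrACA mulrA [P * Q * S]mulrAC -mulrDl mulrCA -[P * Q * T]mulrA -mulrDr.
by apply: dvdp_add; [apply: dvdp_mulr|apply: dvdp_mull].
Qed.

Lemma nlogderivX n P S k : nlogderiv n P S -> nlogderiv n (P ^+ k) (S *+ k).
Proof.
move=> PS; elim: k => [|k IHk]; first exact: nlogderiv1.
by rewrite exprS mulrS; apply: nlogderivM.
Qed.

(** The difference R = P - Q satisfies X R' + R S = 0 modulo X^n. As S has no constant term, the
    coefficient of X^i expresses i R_i through lower coefficients of R, which vanish by induction;
    in characteristic 0 one can divide by i > 0. *)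
Lemma nlogderiv_unique n P Q S T : [pchar F] =i pred0 ->
  congX n S T -> S`_0 = 0 -> P`_0 = Q`_0 ->
  nlogderiv n P S -> nlogderiv n Q T -> congX n P Q.
Proof.
move=> char0 ST S0 PQ0 PS QT.
suff R0 : forall i, (i < n)%N -> (P - Q)`_i = 0.
  by apply/congXP => i /R0; rewrite coefB => /subr0_eq.
have RS : congX n ('X * (P - Q)^`() + (P - Q) * S) 0.
  have QS : congX n ('X * Q^`() + Q * S) 0.
    apply: congX_trans QT; rewrite /congX opprD addrACA subrr add0r -mulrBr.
    exact: dvdp_mull.
  move: PS QS; rewrite /nlogderiv /congX !subr0 derivB mulrBr mulrBl addrACA -opprD.
  exact: dvdp_sub.
move: (P - Q) RS (coefB P Q 0) => R RS; rewrite PQ0 subrr => R0 i.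
have [m] := ubnP i; elim: m => // m IHm in i *; rewrite ltnS => le_im lt_in.
case: i => [|i] // in le_im lt_in *.
have /congXP/(_ _ lt_in) := RS; rewrite coef0 coefD coefXM coef_deriv /=.
rewrite coefM big_ord_recr /= subnn S0 mulr0 addr0 big1 ?addr0 => [/eqP|j _].
  by rewrite -mulr_natr mulf_eq0 (pcharf0P _).1 // orbF => /eqP.
by rewrite (IHm j) ?mul0r //; [exact: leq_trans le_im|exact: ltn_trans lt_in].
Qed.

(** The truncation of 1 / (1 - X^d), as in the Euler factors of [zeta_coef]. *)
Definition geomX n d : {poly F} := \poly_(i < n) (d %| i)%N%:R.

Lemma congX_geom n d : (0 < d)%N -> congX n ((1 - 'X^d) * geomX n d) 1.
Proof.
move=> d_gt0; apply/congXP => i lt_in; rewrite mulrBl mul1r coefB coef_poly lt_in.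
rewrite coefXnM coef1 coef_poly; case: ltnP => [lt_id|le_di].
  rewrite subr0; case: i => [|i] in lt_in lt_id *; first by rewrite dvdn0.
  by rewrite gtnNdvd.
rewrite (leq_ltn_trans (leq_subr _ _) lt_in) dvdn_subl // subrr.
by rewrite gtn_eqF ?(leq_trans d_gt0 le_di).
Qed.

Lemma nlogderiv_geom n d : (0 < d)%N ->
  nlogderiv n (1 - 'X^d) ((geomX n d - 1) *+ d).
Proof.
move=> d_gt0; have := congX_geom n d_gt0; rewrite /nlogderiv /congX subr0 => geo.
rewrite derivB derivC sub0r derivXn mulrN mulrnAr -exprS prednK // mulrnAr.
rewrite addrC -mulrnBl mulrBr mulr1 opprB.
by rewrite -addrA addrAC subrr sub0r -mulr_natr dvdp_mulr.
Qed.

End TruncatedSeries.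

(** * Comparison of the Euler product with the determinant *)

Section ZetaDeterminant.
Variables (Y : digraph) (m N : nat) (C : 'M[rat]_m).
Hypothesis N_gt0 : (0 < N)%N.
Hypothesis card_cyclesE : forall k, (0 < k)%N ->
  #|cycles Y k|%:R = (if (N %| k)%N then \tr (C ^+ (k %/ N)) *+ N else 0) :> rat.

Let c d := #|prime_cycle_classes Y d|.
Let D := det1_sub_XnM N C.

Lemma pchar_rat : [pchar rat] =i pred0.
Proof. exact: Num.Theory.pchar_num. Qed.

Definition euler_trunc K : {poly rat} :=
  \prod_(1 <= d < K.+1) geomX _ K.+1 d ^+ #|prime_cycle_classes Y d|.

Lemma zeta_coefE K : zeta_coef Y K = (euler_trunc K)`_K.
Proof. by congr (polyseq _)`_K; apply: eq_bigr => d _; rewrite prodr_const. Qed.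

Lemma det1_sub_XnM_coef0 : D`_0 = 1.
Proof.
rewrite -horner_coef0 -horner_evalE -det_map_mx (_ : map_mx _ _ = 1%:M) ?det1 //.
apply/matrixP => i j; rewrite !mxE /= /horner_eval !hornerE expr0n gtn_eqF //.
by rewrite mul0r subr0; case: (i == j); rewrite ?hornerC ?horner0.
Qed.

(** The product [P] of the (1 - X^d)^(c d) inverts the truncated Euler product. It agrees with [D]
    modulo X^(K+1), since both have constant term 1 and the same logarithmic derivative, which
    counts cycles. *)
Lemma congX_euler_det K : congX K.+1 (D * euler_trunc K) 1.
Proof.
pose P : {poly rat} := \prod_(1 <= d < K.+1) (1 - 'X^d) ^+ c d.
have PZ : congX K.+1 (P * euler_trunc K) 1.
  rewrite -big_split big_nat; apply: (big_ind (fun q => congX K.+1 q 1)).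
  - exact: congX_refl.
  - by move=> p q p1 q1 /=; rewrite -[X in congX _ _ X]mulr1; apply: congX_mul.
  move=> d /andP[d_gt0 _] /=; rewrite -/(c d) -exprMn.
  elim: (c d) => [|e IHe]; first exact: congX_refl.
  rewrite exprS -[1 in X in congX _ _ X]mulr1.
  by apply: congX_mul IHe; apply: congX_geom.
pose S : {poly rat} := \sum_(1 <= d < K.+1) (geomX _ K.+1 d - 1) *+ d *+ c d.
have PS : nlogderiv K.+1 P S.
  rewrite /P /S !big_nat.
  apply: (big_ind2 (nlogderiv K.+1)) => [||d /andP[d_gt0 _]].
  - exact: nlogderiv1.
  - by move=> P1 S1 P2 S2; apply: nlogderivM.
  by apply/nlogderivX/nlogderiv_geom.
pose T : {poly rat} := \sum_(1 <= k < K.+1) (\tr (C ^+ k) *+ N) *: 'X^(N * k).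
have DT : nlogderiv K.+1 D T.
  have := log_deriv_det1_sub_XnM C K N_gt0; rewrite /nlogderiv /congX subr0.
  by apply/dvdp_trans/dvdp_exp2l; rewrite leq_pmull.
(* Each d dividing i contributes d * c d, the number of prime cycles of length d; these are the
   cycles of length i whose underlying prime cycle has length d. *)
have S_coef i : (i < K.+1)%N -> S`_i = if i == 0%N then 0 else #|cycles Y i|%:R.
  move=> lt_iK; rewrite coef_sum.
  case: (posnP i) => [->|i_gt0].
    rewrite big_nat big1 // => d _; rewrite !coefMn coefB coef1 coef_poly dvdn0.
    by rewrite subrr !mul0rn.
  rewrite card_cycles_prime // natr_sum big_mkcond.
  rewrite [RHS](big_nat_widen _ _ K.+1) //=.
  rewrite [RHS]big_mkcond; apply: eq_big_nat => d /andP[d_gt0 _].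
  rewrite !coefMn coefB coef1 (gtn_eqF i_gt0) subr0 coef_poly lt_iK ltnS.
  case: (boolP (d %| i)%N) => [dvd_di|_]; last by rewrite !mul0rn.
  by rewrite dvdn_leq // card_prime_cycles // -mulrnA mulnC.
have T_coef i : (i < K.+1)%N -> T`_i = if i == 0%N then 0 else #|cycles Y i|%:R.
  move=> lt_iK; rewrite coef_sum.
  under eq_bigr => k _ do rewrite coefZ coefXn.
  case: (posnP i) => [->|i_gt0].
    rewrite big_nat big1 // => k /andP[k_gt0 _].
    by rewrite eq_sym muln_eq0 !gtn_eqF // mulr0.
  rewrite card_cyclesE //.
  case: (boolP (N %| i)%N) => [/dvdnP[k i_def]|ndvd]; last first.
    rewrite big1 ?if_same // => k _; case: eqP => [ik|_]; last by rewrite mulr0.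
    by rewrite ik dvdn_mulr in ndvd.
  have k_gt0 : (0 < k)%N by case: (k) i_def i_gt0 => // ->.
  have lt_kK : (k < K.+1)%N by apply: leq_ltn_trans lt_iK; rewrite i_def leq_pmulr.
  rewrite i_def mulnK // (bigD1_seq k) ?iota_uniq //=; last first.
    by rewrite mem_index_iota k_gt0.
  rewrite mulnC eqxx mulr1 big1 ?addr0 // => l /negPf lk.
  by rewrite eqn_pmul2l // eq_sym lk mulr0.
have PD : congX K.+1 P D.
  apply: nlogderiv_unique PS DT; first exact: pchar_rat.
  - by apply/congXP => i lt_iK; rewrite S_coef ?T_coef.
  - by rewrite S_coef.
  rewrite det1_sub_XnM_coef0 -horner_coef0 horner_prod big_nat.
  rewrite big1 // => d /andP[d_gt0 _].
  by rewrite horner_exp !hornerE expr0n gtn_eqF // subr0 expr1n.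
apply: congX_trans PZ; apply: congX_mul (congX_refl _ _).
exact: congX_sym.
Qed.

(** Modulo X^(j+1) both truncations are inverse to the same [D]. *)
Lemma congX_euler_trunc j K : (j <= K)%N ->
  congX j.+1 (euler_trunc K) (euler_trunc j).
Proof.
move=> le_jK; have DK := congXW (le_jK : (j.+1 <= K.+1)%N) (congX_euler_det K).
rewrite -[X in congX _ X]mulr1 -[X in congX _ _ X]mul1r.
apply: (congX_trans (congX_mul (congX_refl _ _) (congX_sym (congX_euler_det j)))).
rewrite mulrA [_ * D]mulrC.
by apply: congX_mul DK (congX_refl _ _).
Qed.

Lemma conv_zeta_coef (P : {poly rat}) k :
  \sum_(i < k.+1) P`_i * zeta_coef Y (k - i) = (P * euler_trunc k)`_k.
Proof.
rewrite coefM; apply: eq_bigr => i _; rewrite zeta_coefE.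
by rewrite (congXP _ _ _ (congX_euler_trunc (leq_subr i k))).
Qed.

Lemma has_expansion_zeta f :
  has_expansion f (zeta_coef Y) <-> \n_(repr f) * D = \d_(repr f).
Proof.
split=> [expf|nD k]; last first.
  rewrite conv_zeta_coef -nD -[RHS](congr1 (fun q : {poly rat} => q`_k) (mulr1 _)).
  have := congX_mul (congX_refl k.+1 \n_(repr f)) (congX_euler_det k).
  by rewrite mulrA => /congXP->.
apply: congX_eq => -[|k]; first by rewrite /congX expr0 dvd1p.
have expk : congX k.+1 (\d_(repr f) * euler_trunc k) \n_(repr f).
  apply/congXP => i lt_ik; rewrite -expf conv_zeta_coef.
  have := congX_mul (congX_refl i.+1 \d_(repr f))
    (congX_euler_trunc (lt_ik : (i <= k)%N)).
  by move/congXP->.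
apply: congX_trans (congX_mul (congX_sym expk) (congX_refl _ D)) _.
rewrite -mulrA [_ * D]mulrC -[X in congX _ _ X]mulr1.
exact: congX_mul (congX_refl _ _) (congX_euler_det k).
Qed.

Lemma a_inv_mup : a_inv Y = (mup 1 D)%:Z.
Proof.
have D_neq0 : D != 0.
  by apply/eqP => D0; have := det1_sub_XnM_coef0; rewrite D0 coef0 => /eqP.
have /has_expansion_zeta nD : has_expansion (zeta Y) (zeta_coef Y).
  apply: (@xgetPex _ 0 [set f | has_expansion f (zeta_coef Y)]%classic).
  (* The fraction 1 / D has the expansion, so [zeta Y] is not a default value of [xget]. Its
     representative need not be in lowest terms: the denominator is the numerator times [D], and the
     multiplicity of the numerator cancels in [ord_at]. *)
  exists (\pi_({fraction {poly rat}})%qT (Ratio 1 D)); apply/has_expansion_zeta.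
  have := FracField.equivf_l (Ratio 1 D).
  by rewrite !numden_Ratio // mulr1.
have n_neq0 : \n_(repr (zeta Y)) != 0.
  apply/eqP => n0; have := denom_ratioP (repr (zeta Y)).
  by rewrite -nD n0 mul0r eqxx.
by rewrite /a_inv /ord_at -nD mupM // PoszD opprB addrAC subrr add0r.
Qed.

End ZetaDeterminant.
(** * The rank of the Bowen-Franks group *)

Section ZRankQuotient.
Variables (s : nat) (M : 'M[int]_s).

Lemma clear_denominators m n (A : 'M[rat]_(m, n)) :
  exists2 d : int, d != 0 & exists B : 'M[int]_(m, n), map_mx intr B = d%:~R *: A.
Proof.
exists (\prod_(ij : 'I_m * 'I_n) denq (A ij.1 ij.2)).
  by rewrite prodf_seq_neq0; apply/allP => ij _; rewrite denq_neq0.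
exists (\matrix_(i, j) (numq (A i j) *
  \prod_(ij : 'I_m * 'I_n | ij != (i, j)) denq (A ij.1 ij.2))).
apply/matrixP => i j; rewrite !mxE [in RHS](bigD1 (i, j)) //= !intrM numqE.
by rewrite [RHS]mulrC mulrA.
Qed.

Lemma map_intr_mx_inj m n :
  injective (map_mx intr : 'M[int]_(m, n) -> 'M[rat]_(m, n)).
Proof.
move=> A B /matrixP AB; apply/matrixP => i j.
by have := AB i j; rewrite !mxE => /intr_inj.
Qed.

(* A row vector y lies in the row space of M^T iff y *m Q = 0. *)
Let Q := cokermx (map_mx intr M^T : 'M[rat]_s).
Let proj : 'cV[int]_s -> Quotient.quot (mximage M) :=
  \pi_(Quotient.quot (mximage M))%qT.

(** Independence over Z in the quotient is independence over the rationals in the cokernel, because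
    a rational relation becomes integral after scaling. *)
Lemma zfree_cokermxP k (V : 'M[int]_(k, s)) :
  zfree (fun i => proj (row i V)^T) <-> row_free (map_mx intr V *m Q).
Proof.
have projE (c : 'I_k -> int) : \sum_i proj (row i V)^T *~ c i
    = proj ((\row_i c i *m V)^T).
  rewrite mulmx_sum_row [(\sum_i _)^T]raddf_sum /= /proj raddf_sum /=.
  apply: eq_bigr => i _.
  by rewrite mxE linearZ /= -[c i in RHS]intz scaler_int raddfMz.
have proj0 (x : 'rV_s) : proj x^T = 0 <-> exists w : 'rV_s, x = w *m M^T.
  split=> [x0|[w ->]].
    have : x^T \in mximage M.
      by rewrite -[x^T]subr0 Quotient.idealrBE; apply/eqP; rewrite raddf0.
    rewrite unfold_in => /asboolP[w xw]; exists w^T.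
    by rewrite -trmx_mul -xw trmxK.
  have : (w *m M^T)^T - 0 \in mximage M.
    by rewrite subr0 unfold_in; apply/asboolP; exists w^T; rewrite trmx_mul trmxK.
  by rewrite Quotient.idealrBE => /eqP; rewrite raddf0.
split=> [free_V|free_VQ c].
  apply: inj_row_free => x; rewrite mulmxA => /eqP; rewrite -submxE => /submxP[w xw].
  (* Joining [x] and [w] gives one denominator for both sides of the relation x V = w M^T. *)
  have [d d0 [B dxw]] := clear_denominators (row_mx x w).
  have xB : d%:~R *: x = map_mx intr (lsubmx B).
    by rewrite map_lsubmx dxw linearZ /= row_mxKl.
  have wB : d%:~R *: w = map_mx intr (rsubmx B).
    by rewrite map_rsubmx dxw linearZ /= row_mxKr.
  have B0 i : lsubmx B 0 i = 0.
    apply: free_V; rewrite projE; apply/proj0; exists (rsubmx B).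
    have -> : \row_i lsubmx B 0 i = lsubmx B by apply/rowP => j; rewrite mxE.
    apply: map_intr_mx_inj; rewrite !map_mxM /=.
    by rewrite -xB -wB -!scalemxAl xw.
  apply: (scalerI (a := d%:~R)); first by rewrite intr_eq0.
  rewrite xB scaler0; apply/rowP => i; rewrite [LHS]mxE B0 mxE //.
rewrite projE => /proj0[w cVw].
suff : map_mx intr (\row_i c i) = 0 :> 'rV[rat]_k.
  by move=> /rowP c0 i; apply/(@intr_inj rat); have := c0 i; rewrite !mxE.
apply: (row_free_inj free_VQ); rewrite mul0mx mulmxA -map_mxM cVw map_mxM.
by rewrite -mulmxA mulmx_coker mulmx0.
Qed.

Lemma zrank_quot : zrank (Quotient.quot (mximage M))
  = (s - \rank (map_mx intr M : 'M[rat]_s))%N.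
Proof.
pose P k := (exists f : 'I_k -> Quotient.quot (mximage M), zfree f) /\
  forall (l : nat) (g : 'I_l -> Quotient.quot (mximage M)), zfree g -> (l <= k)%N.
have rankQ : \rank Q = (s - \rank (map_mx intr M : 'M[rat]_s))%N.
  by rewrite mxrank_coker -map_trmx mxrank_tr.
rewrite -rankQ; set r := \rank Q.
have Pr : P r.
  split=> [|l g free_g].
    (* A left inverse of [col_base Q] sends [Q] to [row_base Q], whose [\rank Q] rows are
       independent; scaling makes it integral. *)
    have [d d0 [V VE]] := clear_denominators (pinvmx (col_base Q)).
    exists (fun i => proj (row i V)^T); apply/zfree_cokermxP.
    rewrite VE -scalemxAl -[X in _ *m X](mulmx_base Q) mulmxA.
    rewrite mulVpmx ?col_base_full // mul1mx.
    by rewrite -row_leq_rank mxrank_scale_nz ?intr_eq0 // row_leq_rank row_base_free.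
  pose V := \matrix_i (repr (g i))^T.
  have gE i : g i = proj (row i V)^T by rewrite rowK trmxK /proj reprK.
  have /zfree_cokermxP/eqP <- : zfree (fun i => proj (row i V)^T).
    by move=> c; under eq_bigr do rewrite -gE; apply: free_g.
  exact: mxrankM_maxr.
have [[f free_f] max_f] : P (zrank (Quotient.quot (mximage M))).
  by apply: (@xgetPex _ 0%N P); exists r.
case: Pr => -[h free_h] max_h.
by apply/eqP; rewrite eqn_leq (max_h _ _ free_f) (max_f _ _ free_h).
Qed.
End ZRankQuotient.
Lemma map_mxX (R S : pzRingType) (f : {rmorphism R -> S}) m (A : 'M[R]_m) k :
  map_mx f (A ^+ k) = map_mx f A ^+ k.
Proof.
by elim: k => [|k IHk]; rewrite ?expr0 ?map_mx1 // !exprS -IHk -!mulmxE map_mxM.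
Qed.

Definition qadjacency (Y : digraph) : 'M[rat]_#|vertex Y| :=
  map_mx intr (adjacency Y).

Lemma b_invE (Y : digraph) :
  b_inv Y = (#|vertex Y| - \rank (1%:M - qadjacency Y)%R)%N.
Proof. by rewrite /b_inv zrank_quot map_mxB map_mx1. Qed.

(** * Fixed vectors of adjacency matrices in the tower *)

Section Fixed.
Variables (F : fieldType) (m : nat).
Implicit Types A : 'M[F]_m.

Lemma fixed_expmx l (x : 'M_(l, m)) A k : x *m A = x -> x *m A ^+ k = x.
Proof.
by move=> xA; elim: k => [|k IHk]; rewrite ?expr0 ?mulmx1 // exprSr mulmxA IHk.
Qed.

Lemma kermx_1subP l (x : 'M_(l, m)) A :
  reflect (x *m A = x) (x <= kermx (1%:M - A))%MS.
Proof.
by rewrite sub_kermx mulmxBr mulmx1 subr_eq0 eq_sym; apply: eqP.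
Qed.

End Fixed.

Section DerivedKernel.
Variables (p : nat) (X : digraph) (tau : padic_int p).
Variable alpha : edge X -> padic_int p.
Hypotheses (p_pr : prime p) (tau_unit : padic_unit tau).
Hypothesis alphaE : forall e : edge X, alpha e = tau.
Variable n : nat.

Let N := (p ^ n)%N.
Let A := qadjacency X.
Let An := qadjacency (derived alpha n).
Let fst_rank (i : 'I_#|vertex (derived alpha n)|) : 'I_#|vertex X| :=
  enum_rank (enum_val i).1.
Let snd_val (i : 'I_#|vertex (derived alpha n)|) : Zmodpn p n := (enum_val i).2.

Lemma qadjacency_derivedX k i j : (An ^+ k) i j =
  if snd_val i == snd_val j + tau n *+ k
  then (A ^+ k) (fst_rank i) (fst_rank j) else 0.
Proof.
rewrite /An /A /qadjacency -!map_mxX !mxE !nwalks_adjacency !enum_rankK /snd_val.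
case: (enum_val i) (enum_val j) => [v s] [w t] /=.
by rewrite (nwalks_derived alphaE); case: ifP.
Qed.

(* Split a row vector f on X_n into its blocks f_s, s in Z/p^n.  It is fixed by
   An iff f_s = f_(s + tau) A for all s, that is f_(- k tau) = f_0 A^k for all
   k; so f |-> f_0 (the matrix G below) is a bijection from the fixed vectors of
   An to those of A^N, with inverse H. *)
Lemma corank_derived :
  (#|vertex (derived alpha n)| - \rank (1%:M - An)%R
   = #|vertex X| - \rank (1%:M - A ^+ N)%R)%N.
Proof.
have [y yP] := voltage_inverse p_pr tau_unit n.
pose idx (v : vertex X) (s : Zmodpn p n) : 'I_#|vertex (derived alpha n)| :=
  enum_rank (v, s).
have sum_idx (f : 'I_#|vertex (derived alpha n)| -> rat) :
    \sum_i f i = \sum_(b : 'I_#|vertex X|) \sum_s f (idx (enum_val b) s).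
  transitivity (\sum_v \sum_s f (idx v s)); last first.
    rewrite (reindex (@enum_val _ (mem (vertex X)))) /=; last first.
      exact/onW_bij/enum_val_bij.
    by [].
  rewrite pair_bigA (reindex (@enum_rank (vertex (derived alpha n)))) /=; last first.
    exact/onW_bij/enum_rank_bij.
  by apply: eq_bigr => -[v s].
have fst_idx (b : 'I_#|vertex X|) s : fst_rank (idx (enum_val b) s) = b.
  by rewrite /fst_rank /idx enum_rankK enum_valK.
have snd_idx b s : snd_val (idx b s) = s by rewrite /snd_val /idx enum_rankK.
have N_tau : tau n *+ N = 0 by apply/eqP; rewrite voltage_mulrn_eq0.
have tau_congr a b : tau n *+ a = tau n *+ b -> a = b %[mod N].
  wlog le_ba : a b / (b <= a)%N.
    by move=> IH; case: (leqP b a) => [/IH//|/ltnW/IH IHba /esym/IHba].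
  move=> tau_ab; apply/eqP; rewrite eqn_mod_dvd // -(voltage_mulrn_eq0 p_pr tau_unit).
  by rewrite mulrnBr // tau_ab subrr.
(* A number of steps leading from level [s] to level 0; [y] inverts [tau n]. *)
pose kappa (s : Zmodpn p n) : nat := (y * (- s)%R)%N.
have kappaE s : tau n *+ kappa s = - s.
  rewrite Zp_mulrn /kappa mulnA mulnC; apply: val_inj; move: (- s) => u /=.
  move: (nat_of_ord (tau n)) yP => t yt; rewrite mulnC [(t * y)%N]mulnC.
  have lt_u : (nat_of_ord u < N)%N.
    by apply: leq_trans (ltn_ord u) _; rewrite Zmodpn_card.
  move: (nat_of_ord u) lt_u => w lt_w.
  by rewrite Zmodpn_card // -modnMml yt modnMml mul1n modn_small.
pose g (b : 'I_#|vertex X|) := idx (enum_val b) 0.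
have gE i b : (i == g b) = (snd_val i == 0) && (fst_rank i == b).
  apply/eqP/andP => [->|[/eqP s0 /eqP <-]]; first by rewrite snd_idx fst_idx !eqxx.
  rewrite /g /fst_rank enum_rankK /idx -s0 /snd_val -surjective_pairing.
  by rewrite enum_valK.
pose G : 'M[rat]_(#|vertex (derived alpha n)|, #|vertex X|) :=
  \matrix_(i, b) (i == g b)%:R.
have mulG l (B : 'M_(l, #|vertex (derived alpha n)|)) a b :
    (B *m G) a b = B a (g b).
  rewrite mxE (bigD1 (g b)) //= mxE eqxx mulr1 big1 ?addr0 // => i /negPf ib.
  by rewrite mxE ib mulr0.
have Gmul l (B : 'M_(#|vertex X|, l)) i b :
    (G *m B) i b = if snd_val i == 0 then B (fst_rank i) b else 0.
  rewrite mxE; under eq_bigr do rewrite mxE gE.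
  case: eqP => _ /=; last by rewrite big1 // => c _; rewrite mul0r.
  rewrite (bigD1 (fst_rank i)) //= eqxx mul1r big1 ?addr0 // => c /negPf.
  by rewrite eq_sym => ->; rewrite mul0r.
pose H : 'M[rat]_(#|vertex X|, #|vertex (derived alpha n)|) :=
  \matrix_(b, j) (A ^+ kappa (snd_val j)) b (fst_rank j).
have GH i j : (G *m H) i j = (An ^+ kappa (snd_val j)) i j.
  by rewrite Gmul qadjacency_derivedX kappaE subrr mxE.
have AnG : An ^+ N *m G = G *m A ^+ N.
  apply/matrixP => i b; rewrite mulG Gmul qadjacency_derivedX N_tau addr0.
  by rewrite /g snd_idx fst_idx.
have HAn b j :
    (H *m An) b j = (A ^+ (kappa (snd_val j + tau n)).+1) b (fst_rank j).
  rewrite exprSr -mulmxE [LHS]mxE [RHS]mxE sum_idx; apply: eq_bigr => c _.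
  rewrite (bigD1 (snd_val j + tau n)) //= -[An]expr1 qadjacency_derivedX mxE.
  rewrite snd_idx fst_idx mulr1n eqxx expr1 big1 ?addr0 // => s /negPf sj.
  by rewrite qadjacency_derivedX snd_idx mulr1n sj mulr0.
(* On vectors fixed by A^N the powers of A depend only on the exponent modulo N, so the choice of
   representative made by [kappa] is harmless. *)
have fixed_congr l (x : 'M_(l, #|vertex X|)) a b :
    x *m A ^+ N = x -> a = b %[mod N] -> x *m A ^+ a = x *m A ^+ b.
  move=> xN ab; rewrite (divn_eq a N) (divn_eq b N) ab ![(_ * N)%N]mulnC.
  by rewrite !exprD !exprM -!mulmxE !mulmxA !(fixed_expmx _ xN).
rewrite -!mxrank_ker; set K1 := kermx (_ - An); set K2 := kermx (_ - A ^+ N).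
have K1_fix : K1 *m An = K1 by apply/kermx_1subP/submx_refl.
have K2_fix : K2 *m A ^+ N = K2 by apply/kermx_1subP/submx_refl.
have K1GH : K1 *m G *m H = K1.
  rewrite -mulmxA; apply/matrixP => a j.
  rewrite -[in RHS](fixed_expmx (kappa (snd_val j)) K1_fix).
  by rewrite [LHS]mxE [RHS]mxE; apply: eq_bigr => i _; rewrite GH.
have K2HG : K2 *m H *m G = K2.
  apply/matrixP => a b; transitivity ((K2 *m A ^+ kappa 0) a b).
    rewrite mulG [LHS]mxE [RHS]mxE; apply: eq_bigr => c _.
    by rewrite [H _ _]mxE snd_idx fst_idx.
  rewrite (@fixed_congr _ K2 (kappa 0) 0%N) ?expr0 ?mulmx1 //.
  by apply: tau_congr; rewrite kappaE oppr0 mulr0n.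
(* K1 G lies in the kernel K2 and K2 H in K1; as G and H undo each other on these kernels, neither
   rank exceeds the other. *)
apply/eqP; rewrite eqn_leq; apply/andP; split.
  rewrite -{1}K1GH (leq_trans (mxrankM_maxl _ _)) // mxrankS //.
  by apply/kermx_1subP; rewrite -mulmxA -AnG mulmxA fixed_expmx.
rewrite -{1}K2HG (leq_trans (mxrankM_maxl _ _)) // mxrankS //.
apply/kermx_1subP; rewrite -mulmxA; apply/matrixP => a j.
transitivity ((K2 *m A ^+ (kappa (snd_val j + tau n)).+1) a (fst_rank j)).
  by rewrite [LHS]mxE [RHS]mxE; apply: eq_bigr => b _; rewrite HAn.
rewrite (@fixed_congr _ K2 _ (kappa (snd_val j))) //; last first.
  by apply: tau_congr; rewrite mulrSr !kappaE opprD subrK.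
by rewrite [LHS]mxE [RHS]mxE; apply: eq_bigr => b _; rewrite [H _ _]mxE.
Qed.

End DerivedKernel.
(** * Comparison of consecutive layers *)

Section CyclotomicCoprime.
Variables (p k : nat).
Hypothesis p_pr : prime p.

(** The sum times z^(p^k) - 1 is z^(p^(k+1)) - 1, so the order of [z] divides p^(k+1). A smaller
    order would divide p^k, and the sum would be p instead of 0. *)
Lemma primitive_root_pfactor (z : algC) :
  \sum_(i < p) z ^+ (p ^ k * i) = 0 -> (p ^ k.+1).-primitive_root z.
Proof.
move=> sum0; have p_gt0 := prime_gt0 p_pr.
have z_p : z ^+ (p ^ k.+1) = 1.
  apply/eqP; rewrite expnSr exprM -subr_eq0 subrX1.
  by under eq_bigr do rewrite -exprM; rewrite sum0 mulr0.
have [|m prim_m dvd_m] := prim_order_exists _ z_p; first by rewrite expn_gt0 p_gt0.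
have [e le_e m_def] := elimT (dvdn_pfactor m k.+1 p_pr) dvd_m.
move: le_e; rewrite leq_eqVlt => /predU1P[<-|lt_e]; first by rewrite -m_def.
have zM : z ^+ (p ^ k) = 1.
  by apply/eqP; rewrite -(prim_order_dvd prim_m) m_def dvdn_exp2l.
move/eqP: sum0; under eq_bigr do rewrite exprM zM expr1n.
by rewrite sumr_const card_ord pnatr_eq0 (gtn_eqF p_gt0).
Qed.

(** A common root in [algC] would be a primitive p^(k+1)-th root of unity, whose minimal polynomial
    has degree phi(p^(k+1)), more than the degree of [q]. *)
Lemma coprimep_cyclotomic_pfactor (q : {poly rat}) :
  q != 0 -> (size q <= totient (p ^ k.+1))%N ->
  coprimep q (\sum_(i < p) 'X^(p ^ k * i)).
Proof.
move=> q_neq0 le_q; rewrite -(coprimep_map (ratr : {rmorphism rat -> algC})).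
apply/Pdiv.ClosedField.coprimepP => z qz; apply/eqP => sum0.
have prim_z : (p ^ k.+1).-primitive_root z.
  apply: primitive_root_pfactor; rewrite -[RHS]sum0 rmorph_sum horner_sum.
  by apply: eq_bigr => i _; rewrite rmorphXn /= map_polyX hornerXn.
have [f [f_min _] f_dvd] := minCpolyP z.
have := dvdp_leq q_neq0; move/(_ f); rewrite -f_dvd => /(_ qz).
rewrite -(size_map_poly (ratr : {rmorphism rat -> algC})) -f_min.
rewrite (minCpoly_cyclotomic prim_z) size_cyclotomic => lt_q.
by have := leq_trans lt_q le_q; rewrite ltnn.
Qed.

Lemma sum_expmx_unit r (A : 'M[rat]_r) : (r < totient (p ^ k.+1))%N ->
  \sum_(i < p) A ^+ (p ^ k * i) \in unitmx.
Proof.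
case: r A => [|r] A lt_r; first by rewrite unitmxE det_mx00 unitr1.
have := @coprimep_cyclotomic_pfactor (char_poly A).
rewrite monic_neq0 ?char_poly_monic // size_char_poly => /(_ isT lt_r).
(* Evaluating the Bezout identity at A, Cayley-Hamilton kills the term with the characteristic
   polynomial and leaves v(A) Phi(A) = c. *)
case/Bezout_coprimepP=> -[u v] /= /eqpf_eq[c c_neq0 uv].
have := congr1 (horner_mx A) uv.
rewrite rmorphD !rmorphM /= Cayley_Hamilton mulr0 add0r linearZ /= rmorph1.
rewrite rmorph_sum /=; under eq_bigr do rewrite rmorphXn /= horner_mx_X.
move=> vS; have /(congr1 ( *:%R c^-1)) := vS.
rewrite scalerA mulVf // scale1r -mulmxE scalemxAl.
by case/mulmx1_unit.
Qed.

End CyclotomicCoprime.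

Section DefectStep.
Variables (p : nat) (X : digraph) (tau : padic_int p).
Variable alpha : edge X -> padic_int p.
Hypotheses (p_pr : prime p) (tau_unit : padic_unit tau).
Hypothesis alphaE : forall e : edge X, alpha e = tau.

Let A := qadjacency X.

Lemma a_inv_derived n :
  a_inv (derived alpha n) = (mup 1 (det1_sub_XnM (p ^ n) (A ^+ (p ^ n))))%:Z.
Proof.
apply: a_inv_mup => [|k k_gt0]; first by rewrite expn_gt0 prime_gt0.
have /(congr1 (intr : int -> rat)) := card_cycles_derived p_pr tau_unit alphaE n k_gt0.
rewrite -pmulrn => ->; case: (boolP (_ %| _)%N) => // dvd_k.
by rewrite -exprM mulnC divnK // /A /qadjacency -map_mxX trace_map_mx raddfMn.
Qed.

Lemma b_inv_derived n :
  b_inv (derived alpha n) = (#|vertex X| - \rank (1%:M - A ^+ (p ^ n))%R)%N.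
Proof. by rewrite b_invE (corank_derived p_pr tau_unit alphaE). Qed.

Lemma defect_derivedS n : (#|vertex X| < totient (p ^ n.+1))%N ->
  defect (derived alpha n.+1) = defect (derived alpha n).
Proof.
move=> lt_r; have Phi_unit := sum_expmx_unit p_pr A lt_r.
have PhiE : \sum_(i < p) A ^+ (p ^ n * i) = \sum_(i < p) (A ^+ (p ^ n)) ^+ i.
  by apply: eq_bigr => i _; rewrite exprM.
have geo (R : pzRingType) (B : R) : 1 - B ^+ p = (1 - B) * \sum_(i < p) B ^+ i.
  by rewrite -[1 - _]opprB subrX1 -mulNr opprB.
have aE : a_inv (derived alpha n.+1) = a_inv (derived alpha n).
  rewrite !a_inv_derived expnSr exprM /det1_sub_XnM -expmx_scaleX.
  (* The second determinant takes the value det Phi(A) at u = 1, which is nonzero, so it does not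
     affect the multiplicity of 1. *)
  rewrite geo -mulmxE det_mulmx mupMl // /root -horner_evalE -det_map_mx.
  rewrite -unitfE -unitmxE raddf_sum /=.
  rewrite (_ : \sum_i _ = \sum_(i < p) A ^+ (p ^ n * i)) //.
  apply: eq_bigr => i _; rewrite expmx_scaleX; apply/matrixP => a b; rewrite !mxE.
  by rewrite /horner_eval !hornerE !expr1n mul1r exprM.
have bE : b_inv (derived alpha n.+1) = b_inv (derived alpha n).
  rewrite !b_inv_derived expnSr exprM geo -mulmxE mxrankMfree //.
  by rewrite row_free_unit -PhiE.
by rewrite /defect aE bE.
Qed.

End DefectStep.

Theorem lemma7p9 (p r : nat) (X : digraph) (tau : padic_int p)
    (alpha : edge X -> padic_int p) :
  prime p ->
  strongly_connected X ->
  #|vertex X| = r ->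
  padic_unit tau ->
  (forall e : edge X, alpha e = tau) ->
  [/\ forall n : nat, (r < totient (p ^ n))%N ->
        defect (derived alpha n) = defect (derived alpha n.-1),
      exists B : int, forall n : nat, `|defect (derived alpha n)| <= B
    & (r < p.-1)%N ->
        forall m n : nat, defect (derived alpha m) = defect (derived alpha n)].
Proof.
move=> p_pr _ <-{r} tau_unit alphaE.
have step n : (#|vertex X| < totient (p ^ n.+1))%N ->
    defect (derived alpha n.+1) = defect (derived alpha n).
  exact: (defect_derivedS p_pr tau_unit alphaE).
have totientE n : totient (p ^ n.+1) = (p.-1 * p ^ n)%N by rewrite totient_pfactor.
have p1_gt0 : (0 < p.-1)%N by rewrite -ltnS prednK ?prime_gt0 ?prime_gt1.
(* For n = 0 the predecessor [n.-1] is again 0 and the first claim is trivial. *)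
split=> [[|n] // /step|| lt_r] //.
- set r := #|vertex X| in step; pose d n := `|defect (derived alpha n)|.
  (* The values are constant from level r on: for n >= r, phi(p^(n+1)) >= p^n > n >= r. *)
  exists (\sum_(i < r.+1) d i) => n.
  have le_sum i : (i <= r)%N -> d i <= \sum_(j < r.+1) d j.
    move=> le_ir; rewrite (bigD1 (Ordinal (le_ir : (i < r.+1)%N))) //= lerDl.
    by rewrite sumr_ge0 // => j _; rewrite normr_ge0.
  case: (leqP n r) => [/le_sum // | /ltnW].
  elim: n => [|n IHn]; first by move=> _; apply: le_sum.
  rewrite leq_eqVlt => /predU1P[<-|]; first exact: le_sum.
  rewrite ltnS => le_rn; rewrite step ?IHn // totientE.
  apply: leq_trans (leq_pmull _ p1_gt0).
  exact: leq_ltn_trans le_rn (ltn_expl _ (prime_gt1 p_pr)).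
(* Here phi(p^(n+1)) >= p - 1 > r already at every level. *)
have cst n : defect (derived alpha n) = defect (derived alpha 0).
  elim: n => // n IHn; rewrite step // totientE (leq_trans lt_r) // leq_pmulr //.
  by rewrite expn_gt0 prime_gt0.
by move=> m n; rewrite !cst.
Qed.
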